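(* Let $f_1,f_2,\ldots,f_n:D\to\mathbb{R}$ be continuous periodic functions which are nonconstant on their common domain $D\subset\mathbb{R}$, and let $T_i$ be a period of $f_i$ $(i=1,\ldots,n)$. Suppose that all sums of the $f_i$'s in which the number of summands is less than $n$ are nonconstant, i.e. for every nonempty proper subset $I\subsetneq\{1,\ldots,n\}$ the function $\sum_{i\in I}f_i$ is nonconstant on $D$. Then the sum $f_1+\cdots+f_n$ is periodic if and only if the periods $T_1,\ldots,T_n$ are (pairwise) commensurable.
   Context: A function $f$ with domain $D\subset\mathbb{R}$ is called periodic (or $T$-periodic) if, for some real $T\neq0$, $D+T=D$ and $f(x+T)=f(x)$ for all $x\in D$; then $T$ is called a period of $f$. Periods are assumed positive. Two nonzero real numbers are commensurable if their ratio is rational. The set $D$ is an arbitrary subset of $\mathbb{R}$ (not necessarily all of $\mathbb{R}$), and continuity is with respect to the subspace topology on $D$. *)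

(* Defs.v *)
From mathcomp Require Import all_boot all_order all_algebra.
From mathcomp Require Import all_classical all_reals all_analysis.
Import Order.TTheory GRing.Theory Num.Theory.
Import numFieldNormedType.Exports.

Set Implicit Arguments.
Unset Strict Implicit.
Unset Printing Implicit Defensive.

Local Open Scope classical_set_scope.
Local Open Scope ring_scope.

(* A function with domain D is represented by a total function R -> R of which
   only the values on D are ever used. *)

Definition is_period (R : realType) (D : set R) (f : R -> R) (T : R) : Prop :=
  [/\ T != 0, [set x + T | x in D] = D & forall x, D x -> f (x + T) = f x].

Definition periodic_on (R : realType) (D : set R) (f : R -> R) : Prop :=
  exists T, is_period D f T.

Definition nonconstant_on (R : realType) (D : set R) (f : R -> R) : Prop :=
  ~ exists c, forall x, D x -> f x = c.

Definition commensurable (R : realType) (x y : R) : Prop :=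
  [/\ x != 0, y != 0 & exists q : rat, x / y = ratr q].

(* Main.v *)
(* Let S be a period of the total sum, C a commensurability class of the T_i
   incommensurable with S (one exists if there are two classes), and F the sum of
   the f_i over C, which is itself periodic.
   The differences f_i(x + S) - f_i(x) sum to 0; by induction on the number of
   functions, a constant sum of continuous periodic functions has constant
   partial sums over each commensurability class, so F(x + S) - F(x) is a
   constant c.  Since D carries no compactness, F need not be bounded; instead
   c = 0 and the constancy of F both come from density of the group generated
   by S and a period of F. *)
Require Import Defs.
From mathcomp Require Import all_boot all_order all_algebra.
From mathcomp Require Import all_classical all_reals all_analysis.
From mathcomp Require Import ring lra.
Import Order.TTheory GRing.Theory Num.Theory.
Import numFieldNormedType.Exports.

Set Implicit Arguments.
Unset Strict Implicit.
Unset Printing Implicit Defensive.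

Local Open Scope classical_set_scope.
Local Open Scope ring_scope.

(** * Commensurability and common multiples *)

Lemma commensurable_sym (R : realType) (x y : R) :
  commensurable x y -> commensurable y x.
Proof.
by case=> x0 y0 [q qE]; split=> //; exists q^-1; rewrite fmorphV /= -qE invf_div.
Qed.

Lemma commensurable_trans (R : realType) (y x z : R) :
  commensurable x y -> commensurable y z -> commensurable x z.
Proof.
case=> x0 y0 [q qE] [_ z0 [r rE]]; split=> //; exists (q * r).
by rewrite rmorphM /= -qE -rE mulrA divfK.
Qed.

Lemma commensurableP (R : realType) (x y : R) : x != 0 -> y != 0 ->
  commensurable x y <-> exists k l : int, k != 0 /\ x *~ k = y *~ l.
Proof.
move=> x0 y0; split=> [[_ _ [q qE]]|[k [l [k0 kl]]]].
  exists (denq q), (numq q); split; first exact: denq_neq0.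
  have dq0 : (denq q)%:~R != 0 :> R by rewrite intr_eq0 denq_neq0.
  have -> : x = ratr q * y by rewrite -qE divfK.
  by rewrite -mulrzr -[RHS]mulrzr /ratr mulrAC divfK// mulrC.
split=> //; exists (l%:~R / k%:~R); rewrite fmorph_div !rmorph_int.
apply/eqP; rewrite eqr_div// ?intr_eq0//.
by rewrite !mulrzr mulrC mulrzr kl.
Qed.

(** Each index has its own multiplier [d i]; by finiteness their product serves all indices at
    once. *)
Lemma commensurable_multiple (R : realType) (I : finType) (A : {set I})
    (T : I -> R) (T0 : R) : T0 != 0 ->
  (forall i, i \in A -> commensurable T0 (T i)) ->
  exists2 a : int, a != 0 & forall i, i \in A ->
    exists k : int, T0 *~ a = T i *~ k.
Proof.
move=> T00 hA.
have /choice[d dP] : forall i, exists d : int, d != 0 /\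
    (i \in A -> exists k : int, T0 *~ d = T i *~ k).
  move=> i; case: (boolP (i \in A)) => [iA|_]; last by exists 1.
  have [_ Ti0 _] := hA i iA.
  have [] := (commensurableP T00 Ti0).1 (hA i iA).
  by move=> k [l [k0 kl]]; exists k; split=> // _; exists l.
exists (\prod_i d i).
  by apply/prodf_neq0 => i _; have [] := dP i.
move=> i iA; have [_ /(_ iA)[k kE]] := dP i.
exists (k * \prod_(j | j != i) d j).
by rewrite (bigD1 i)//= !mulrzA kE.
Qed.

(** * Diophantine approximation *)

(** Dirichlet's pigeonhole argument on the fractional parts of the multiples of [x / y]. Distinct
    pigeons give [k != 0]. *)
Lemma small_combination (R : realType) (x y e : R) : y != 0 -> 0 < e ->
  exists k l : int, k != 0 /\ `|x *~ k + y *~ l| < e.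
Proof.
move=> y0 e0; pose a := x / y.
(* Fractional parts in the same box differ by less than [1 / N]; multiplied by [y], the gap must
   stay below [e]. *)
pose N := (Num.bound (`|y| / e)).+1.
have N0 : 0 < N%:R :> R by rewrite ltr0n.
have Nbig : `|y| / N%:R < e.
  rewrite ltr_pdivrMr// mulrC -ltr_pdivrMr//.
  apply: (lt_le_trans (archi_boundP _)); first by rewrite divr_ge0// ltW.
  by rewrite ler_nat /N.
pose fr (i : nat) := a *+ i - (Num.floor (a *+ i))%:~R.
have fr_itv i : 0 <= fr i < 1.
  have := floor_itv (a *+ i); rewrite intrD /fr; lra.
have box_lt i : (Num.trunc (N%:R * fr i) < N)%N.
  have /andP[f0 f1] := fr_itv i.
  rewrite truncn_lt_nat ?mulr_ge0// ?ler0n//.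
  by rewrite -[ltRHS]mulr1 ltr_pM2l.
pose box (i : 'I_N.+1) : 'I_N := Ordinal (box_lt i).
have /injectivePn[i [j ij bij]] : ~~ injectiveb box.
  apply/negP => /injectiveP /leq_card; by rewrite !card_ord ltnn.
have close : `|fr i - fr j| < N%:R^-1.
  have /andP[fi0 fi1] := fr_itv i; have /andP[fj0 fj1] := fr_itv j.
  have := truncn_itv (mulr_ge0 (ltW N0) fi0).
  have := truncn_itv (mulr_ge0 (ltW N0) fj0).
  have -> : Num.trunc (N%:R * fr i) = Num.trunc (N%:R * fr j).
    exact: (congr1 val bij).
  rewrite -natr1 => /andP[h1 h2] /andP[h3 h4].
  rewrite -[ltRHS]mul1r ltr_pdivlMr// -[N%:R in ltLHS]ger0_norm ?ltW//.
  by rewrite -normrM ltr_norml; apply/andP; split; lra.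
exists (i%:Z - j%:Z), (Num.floor (a *+ j) - Num.floor (a *+ i)); split.
  by rewrite subr_eq0 eqz_nat.
suff -> : x *~ (i%:Z - j%:Z) +
    y *~ (Num.floor (a *+ j) - Num.floor (a *+ i)) = (fr i - fr j) * y.
  rewrite normrM; apply: le_lt_trans Nbig.
  by rewrite mulrC ler_pM2l ?normr_gt0// ltW.
have -> : x = a * y by rewrite divfK.
rewrite /fr -[_ *~ (_ - _)]mulrzr -[_ *~ (Num.floor _ - _)]mulrzr !intrB.
rewrite -!pmulrn -[a *+ i]mulr_natr -[a *+ j]mulr_natr; ring.
Qed.

(** Incommensurability makes a small combination [u] nonzero, and the multiples of [u] then form a
    grid of mesh less than [e]. *)
Lemma dense_combination (R : realType) (x y : R) : x != 0 -> y != 0 ->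
  ~ commensurable x y -> forall z e : R, 0 < e ->
  exists k l : int, `|z - (x *~ k + y *~ l)| < e.
Proof.
move=> x0 y0 ncomm z e e0.
have [k [l [k0 small]]] := small_combination x y0 e0.
set u := x *~ k + y *~ l in small.
have u0 : u != 0.
  apply/eqP => u_eq0; apply: ncomm; apply/commensurableP => //.
  exists k, (- l); split=> //.
  by rewrite mulrNz; apply/eqP; rewrite -addr_eq0 -/u u_eq0.
pose m := Num.floor (z / u).
exists (k * m), (l * m); apply: le_lt_trans small.
have -> : x *~ (k * m) + y *~ (l * m) = m%:~R * u.
  by rewrite !mulrzA -mulrzDl mulrC mulrzr.
have -> : z - m%:~R * u = (z / u - m%:~R) * u by rewrite mulrBl divfK.
rewrite normrM -[leRHS]mul1r ler_wpM2r// ler_norml.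
have := floor_itv (z / u); rewrite intrD -/m; lra.
Qed.

(** * Shifts of the domain and multiples of a period *)

Definition shift_invariant (R : realType) (D : set R) (S : R) : Prop :=
  forall x, D (x + S) <-> D x.

Lemma is_periodP (R : realType) (D : set R) (f : R -> R) (T : R) :
  is_period D f T <->
  [/\ T != 0, shift_invariant D T & forall x, D x -> f (x + T) = f x].
Proof.
split=> -[T0 DT fT]; split=> //.
  move=> x; split=> [DxT|Dx]; last by rewrite -DT; exists x.
  by move: DxT; rewrite -[in D _]DT => -[y Dy /addIr <-].
apply/seteqP; split=> [_ [x Dx <-]|x Dx]; first exact/DT.
by exists (x - T); [apply/DT|]; rewrite subrK.
Qed.

(** The increment [c] is kept general because a class sum is at first only known to change by a
    constant under [S]; [c = 0] is the periodic case. *)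
Lemma drift_multiple (R : realType) (D : set R) (F : R -> R) (S c : R) :
  shift_invariant D S -> (forall x, D x -> F (x + S) = F x + c) ->
  forall (k : int) x, D x -> D (x + S *~ k) /\ F (x + S *~ k) = F x + c *~ k.
Proof.
move=> DS FS.
have nat_case (n : nat) x : D x ->
    D (x + S *+ n) /\ F (x + S *+ n) = F x + c *+ n.
  elim: n => [|n IHn] Dx; first by rewrite !mulr0n !addr0.
  have [Dn Fn] := IHn Dx.
  by rewrite !mulrSr !addrA; split; [apply/DS|rewrite FS// Fn].
case=> n x Dx; first exact: nat_case.
have DN (m : nat) y : D y -> D (y - S *+ m).
  elim: m => [|m IHm] Dy; first by rewrite mulr0n subr0.
  by apply/DS; rewrite mulrSr opprD addrA subrK; exact: IHm.
(* A negative multiple is undone by moving forward again from the shifted point. *)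
rewrite NegzE !mulrNz -!pmulrn; split; first exact: DN.
have [_] := nat_case n.+1 _ (DN n.+1 x Dx).
by rewrite subrK => ->; rewrite addrK.
Qed.

Lemma is_period_multiple (R : realType) (D : set R) (f : R -> R) (T : R)
    (k : int) : k != 0 -> is_period D f T -> is_period D f (T *~ k).
Proof.
move=> k0 /is_periodP[T0 DT fT]; apply/is_periodP.
have fT0 x : D x -> f (x + T) = f x + 0 by move=> Dx; rewrite addr0 fT.
split=> [|x|x Dx]; first by rewrite mulrz_eq0 negb_or k0.
  split=> [Dx|Dx]; last by have [] := drift_multiple DT fT0 k Dx.
  have [+ _] := drift_multiple DT fT0 (- k) Dx.
  by rewrite mulrNz addrK.
by have [_ ->] := drift_multiple DT fT0 k Dx; rewrite mul0rz addr0.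
Qed.

(** * Continuity relative to [D], and functions with constant drift *)

Lemma within_continuousP (R : realType) (D : set R) (f : R -> R) :
  {within D, continuous f} <-> forall x, D x -> forall e, 0 < e ->
    exists2 d, 0 < d & forall y, D y -> `|x - y| < d -> `|f x - f y| < e.
Proof.
rewrite subspace_continuousP; split=> h x Dx.
  move=> e e0; have /cvgrPdist_lt /(_ e e0) := h x Dx.
  rewrite near_withinE => /nbhs_ballP[d /= d0 dP].
  by exists d => // y Dy xy; apply: dP.
apply/cvgrPdist_lt => e e0; rewrite near_withinE.
have [d d0 dP] := h x Dx e e0.
by apply/nbhs_ballP; exists d => //= y xy Dy; apply: dP.
Qed.

Lemma within_continuous_sum (R : realType) (D : set R) (I : finType)
    (P : pred I) (f : I -> R -> R) :
  (forall i, {within D, continuous (f i)}) ->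
  {within D, continuous (fun x => \sum_(i | P i) f i x)}.
Proof.
move=> fc x; apply: cvg_big => [|i _]; last exact: fc.
exact: add_continuous.
Qed.

Lemma within_continuous_difference (R : realType) (D : set R) (S : R)
    (f : R -> R) : shift_invariant D S -> {within D, continuous f} ->
  {within D, continuous (fun x => f (x + S) - f x)}.
Proof.
move=> DS fc x; apply: continuousB; last exact: fc.
move: x; apply/within_continuousP => x Dx e e0.
have [d d0 dP] := (within_continuousP D f).1 fc (x + S) ((DS x).2 Dx) e e0.
exists d => // y Dy xy; apply: dP; first exact/DS.
by rewrite opprD addrACA subrr addr0.
Qed.

(* If x + k S + l S' is close to x with k != 0, then F changes by k c between
   these points, so continuity at x forces c = 0; then F is invariant under
   the dense group generated by S and S'. *)
Lemma drift_constant (R : realType) (D : set R) (F : R -> R) (S S' c : R) :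
  {within D, continuous F} -> S != 0 -> shift_invariant D S ->
  (forall x, D x -> F (x + S) = F x + c) -> is_period D F S' ->
  ~ commensurable S S' -> exists c', forall x, D x -> F x = c'.
Proof.
move=> /within_continuousP Fc S0 DS FS /is_periodP[S'0 DS' FS'] ncomm.
have [[x0 Dx0]|Dempty] := pselect (exists x, D x); last first.
  by exists 0 => x Dx; case: Dempty; exists x.
have FS'0 x : D x -> F (x + S') = F x + 0 by move=> Dx; rewrite addr0 FS'.
have move_by x k l : D x ->
    D (x + (S *~ k + S' *~ l)) /\ F (x + (S *~ k + S' *~ l)) = F x + c *~ k.
  move=> Dx; have [Dk Fk] := drift_multiple DS FS k Dx.
  have [Dl Fl] := drift_multiple DS' FS'0 l Dk.
  by rewrite addrA Fl Fk mul0rz addr0.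
have c0 : c = 0.
  apply/eqP/negPn/negP => cn0.
  (* The tolerance is [|c|] because [|c *~ k| >= |c|] for every nonzero integer [k]. *)
  have [d d0 dP] := Fc x0 Dx0 `|c| ltac:(by rewrite normr_gt0).
  have [k [l [k0 small]]] := small_combination S S'0 d0.
  have [Du Fu] := move_by x0 k l Dx0.
  have := dP _ Du; rewrite opprD addrA subrr sub0r normrN => /(_ small).
  rewrite Fu opprD addrA subrr sub0r normrN -mulrzr normrM.
  apply/negP; rewrite -leNgt ler_peMr// -intr_norm ler1z.
  by rewrite -gtz0_ge1 normr_gt0.
exists (F x0) => x Dx; apply/eqP; rewrite -subr_eq0 -normr_eq0.
rewrite eq_le normr_ge0 andbT; apply/ler_addgt0Pr => e e0; rewrite add0r ltW//.
have [d d0 dP] := Fc x Dx e e0.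
have [k [l close]] := dense_combination S0 S'0 ncomm (x - x0) d0.
have [Du Fu] := move_by x0 k l Dx0.
have := dP _ Du; rewrite opprD addrA => /(_ close).
by rewrite Fu c0 mul0rz addr0.
Qed.

(** * Sums over commensurability classes *)

(** Classes are read off [T] alone, so the same class can be summed for [f] and for its
    differences. *)
Definition class_sum (R : realType) (I : finType) (T : I -> R) (A : {set I})
    (i : I) (f : I -> R -> R) (x : R) : R :=
  \sum_(j | (j \in A) && `[< commensurable (T i) (T j) >]) f j x.

Lemma class_sum_period (R : realType) (D : set R) (I : finType) (T : I -> R)
    (A : {set I}) (i : I) (f : I -> R -> R) :
  (forall j, is_period D (f j) (T j)) ->
  exists2 a : int, a != 0 & is_period D (class_sum T A i f) (T i *~ a) /\
    forall j, j \in A -> commensurable (T i) (T j) ->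
      is_period D (f j) (T i *~ a).
Proof.
move=> fT; have [Ti0 _ _] := fT i.
have [||a a0 aP] := @commensurable_multiple R I
  [set j in A | `[< commensurable (T i) (T j) >]]%SET T (T i) => //.
  by move=> j; rewrite inE => /andP[_ /asboolP].
have Tia0 : T i *~ a != 0 by rewrite mulrz_eq0 negb_or a0.
have per j : j \in A -> commensurable (T i) (T j) ->
    is_period D (f j) (T i *~ a).
  move=> jA ij; have [|k kE] := aP j; first by rewrite inE jA; apply/asboolP.
  rewrite kE; apply: is_period_multiple => //.
  by apply: contraNneq Tia0 => k0; rewrite kE k0 mulr0z.
exists a => //; split=> //; apply/is_periodP; split=> //.
  (* Invariance of [D] is taken from [f i], as the class may have no member in [A]. *)
  by have /is_periodP[] := is_period_multiple a0 (fT i).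
move=> x Dx; apply: eq_bigr => j /andP[jA /asboolP ij].
by have [_ _ ->] := per j jA ij.
Qed.

(** The class sum drifts by [c] along [S] and has a multiple of [T i] as period, which is
    incommensurable with [S]; so [drift_constant] applies. *)
Lemma class_sum_constant_of_difference (R : realType) (D : set R)
    (I : finType) (T : I -> R) (A : {set I}) (i : I) (f : I -> R -> R)
    (S c : R) :
  (forall j, {within D, continuous (f j)}) ->
  (forall j, is_period D (f j) (T j)) ->
  S != 0 -> shift_invariant D S -> ~ commensurable S (T i) ->
  (forall x, D x ->
    class_sum T A i (fun j x => f j (x + S) - f j x) x = c) ->
  exists c', forall x, D x -> class_sum T A i f x = c'.
Proof.
move=> fc fT S0 DS nST diff.
have [a a0 [aP _]] := class_sum_period A i fT.
have [Ti0 _ _] := fT i; have [Tia0 _ _] := aP.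
apply: (@drift_constant R D _ S (T i *~ a) c) => //.
- exact: within_continuous_sum.
- move=> x Dx; rewrite -(diff x Dx) /class_sum -big_split /=.
  by apply: eq_bigr => j _; rewrite subrKC.
- move=> SaT; apply: nST; apply: commensurable_trans SaT _.
  by apply/commensurableP => //; exists 1, a.
Qed.

Lemma is_period_difference (R : realType) (D : set R) (f : R -> R) (S T : R) :
  shift_invariant D S -> is_period D f T ->
  is_period D (fun x => f (x + S) - f x) T.
Proof.
move=> DS [T0 DT fT]; split=> // x Dx.
by rewrite addrAC !fT//; apply/DS.
Qed.

(* Differencing by a common period of one commensurability class kills that
   class, which drives the induction on the number of functions. *)
Lemma class_sum_constant (R : realType) (D : set R) (I : finType) (T : I -> R)
    (A : {set I}) (f : I -> R -> R) (c : R) :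
  (forall j, {within D, continuous (f j)}) ->
  (forall j, is_period D (f j) (T j)) ->
  (forall x, D x -> \sum_(j in A) f j x = c) ->
  forall i, i \in A -> exists c', forall x, D x -> class_sum T A i f x = c'.
Proof.
have [n] := ubnP #|A|; elim: n => // n IHn in A f c * => cardA fc fT sumA i iA.
have [all_comm|] := pselect (forall j, j \in A -> commensurable (T i) (T j)).
  exists c => x Dx; rewrite -(sumA x Dx); apply: eq_bigl => j.
  by case: (boolP (j \in A)) => //= jA; apply/asboolP/all_comm.
move=> /existsNP[k /not_implyP[kA nik]].
have [a a0 [aP killed]] := class_sum_period A k fT.
have /is_periodP[S0 DS _] := aP.
set S := T k *~ a in aP killed S0 DS.
pose g j x := f j (x + S) - f j x.
(* The differences [g] vanish on the class of [k], so those over the smaller set [B] still sum to a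
   constant, namely 0. *)
pose B := [set j in A | ~~ `[< commensurable (T k) (T j) >]]%SET.
have iB : i \in B.
  by rewrite inE iA; apply/asboolPn => /commensurable_sym.
have [Tk0 _ _] := fT k.
have kk : commensurable (T k) (T k) by apply/commensurableP => //; exists 1, 1.
have cardB : (#|B| < n)%N.
  rewrite -ltnS; apply: leq_trans cardA; apply: proper_card; apply/properP.
  split; first by apply/fintype.subsetP => j; rewrite inE => /andP[].
  by exists k => //; rewrite inE kA /= negbK; apply/asboolP.
have sumB x : D x -> \sum_(j in B) g j x = 0.
  move=> Dx.
  have : \sum_(j in A) g j x = 0.
    by rewrite sumrB !sumA ?subrr//; apply/DS.
  rewrite (bigID (fun j => `[< commensurable (T k) (T j) >]))/= big1 ?add0r.
    by apply: etrans; apply: eq_bigl => j; rewrite inE.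
  by move=> j /andP[jA /asboolP kj]; have [_ _ fS] := killed j jA kj;
    rewrite /g fS// subrr.
have [] := IHn B g 0 cardB _ _ sumB i iB.
- by move=> j; apply: within_continuous_difference.
- by move=> j; apply: is_period_difference.
move=> c' c'P.
apply: (@class_sum_constant_of_difference R D I T A i f S c') => //.
  have kS : commensurable (T k) S by apply/commensurableP => //; exists a, 1.
  by move=> Si; apply: nik; apply: commensurable_sym;
    apply: commensurable_trans Si.
(* The class of [i] is disjoint from that of [k], so it is the same in [A] and in [B]. *)
move=> x Dx; rewrite -(c'P x Dx) /class_sum /=; apply: eq_bigl => j.
rewrite inE; case: (j \in A) => //=; case: asboolP => //=; rewrite ?andbF// andbT => ij.
by apply/esym/asboolPn => kj; apply: nik;
  apply: commensurable_trans ij (commensurable_sym kj).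
Qed.

Theorem theorem1 (R : realType) (n : nat) (hn : (0 < n)%N)
    (D : set R) (f : 'I_n -> R -> R) (T : 'I_n -> R)
    (f_cont : forall i, {within D, continuous (f i)})
    (f_nonconst : forall i, nonconstant_on D (f i))
    (T_gt0 : forall i, 0 < T i)
    (T_period : forall i, is_period D (f i) (T i))
    (subsums_nonconst : forall I : {set 'I_n},
       I != finset.set0 -> I \proper finset.setT ->
       nonconstant_on D (fun x => \sum_(i in I) f i x)) :
  periodic_on D (fun x => \sum_(i < n) f i x) <->
  (forall i j : 'I_n, commensurable (T i) (T j)).
Proof.
have T0 i : T i != 0 by rewrite gt_eqF.
split=> [[S] /is_periodP[S0 DS sumS] i j|comm]; last first.
  pose i0 := Ordinal hn.
  have [a _ [aP _]] := class_sum_period finset.setT i0 T_period.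
  exists (T i0 *~ a).
  (* With all periods commensurable, the class of [i0] is the whole index set. *)
  suff <- : class_sum T finset.setT i0 f = (fun x => \sum_(i < n) f i x) by [].
  apply/funext => x; apply: eq_bigl => j; rewrite inE /=.
  exact/asboolP.
apply: contrapT => nij.
(* Otherwise the class of [i1] has a constant sum, yet it contains [i1] and misses [j1], against
   [subsums_nonconst]. Applied to both [i] and [j], this makes them commensurable through [S]. *)
have class_S i1 j1 : ~ commensurable (T i1) (T j1) -> commensurable S (T i1).
  move=> nij1; apply: contrapT => nSi.
  have [] := @class_sum_constant R D _ T finset.setT
    (fun i x => f i (x + S) - f i x) 0 _ _ _ i1 (finset.in_setT i1).
  - by move=> k; apply: within_continuous_difference.
  - by move=> k; apply: is_period_difference.
  - move=> x Dx; rewrite sumrB.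
    by under [X in X - _]eq_bigl do rewrite inE;
      under [X in _ - X]eq_bigl do rewrite inE; rewrite sumS// subrr.
  move=> c cP.
  have [c' c'P] := class_sum_constant_of_difference
    f_cont T_period S0 DS nSi cP.
  apply: (subsums_nonconst [set k | `[< commensurable (T i1) (T k) >]]%SET).
  - apply/set0Pn; exists i1; rewrite inE; apply/asboolP.
    by apply/commensurableP => //; exists 1, 1.
  - apply/properP; split; first exact: finset.subsetT.
    by exists j1; rewrite ?inE//; apply/asboolPn.
  exists c' => x Dx; rewrite -(c'P x Dx) /class_sum /=; apply: eq_bigl => k.
  by rewrite !inE.
have Si := class_S i j nij.
have Sj : commensurable S (T j).
  by apply: (class_S j i) => /commensurable_sym.
by apply: nij; apply: commensurable_trans Sj; apply: commensurable_sym.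
Qed.
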